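(* There is an absolute constant $C>0$ such that the following holds. Let $x\ge 2$ and let $A\subset \mathbb{N}\cap[x,\infty)$ be a primitive set. Then $$f(A)=\sum_{a\in A}\frac{1}{a\log a}\le 1+\frac{C}{\log x}.$$
   Context: $\mathbb{N}=\{1,2,3,\dots\}$. A set $A\subset\mathbb{N}$ is primitive if no element of $A$ divides another distinct element of $A$. For a set $A$ of integers $\ge 2$, $f(A)\coloneq\sum_{a\in A}\frac{1}{a\log a}$. *)

(* Defs.v *)
From HB Require Import structures.
From mathcomp Require Import all_boot all_order all_algebra.
From mathcomp Require Import all_classical all_reals all_analysis.
Set Implicit Arguments. Unset Strict Implicit. Unset Printing Implicit Defensive.
Import Order.TTheory GRing.Theory Num.Theory.
Local Open Scope classical_set_scope.
Local Open Scope ring_scope.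

Definition primitive (A : set nat) : Prop :=
  forall a b : nat, A a -> A b -> (a %| b)%N -> a = b.

Definition fsum (R : realType) (A : set nat) : \bar R :=
  \esum_(a in A) (((a%:R : R) * ln (a%:R : R))^-1)%:E.

(* Main.v *)
Require Import Defs.
From HB Require Import structures.
From mathcomp Require Import all_boot all_order all_algebra.
From mathcomp Require Import all_classical all_reals all_analysis.
From mathcomp Require Import zify ring lra.
Set Implicit Arguments. Unset Strict Implicit. Unset Printing Implicit Defensive.
Import Order.TTheory GRing.Theory Num.Theory.
Local Open Scope classical_set_scope.
Local Open Scope ring_scope.

(* Let [L] be the von Mangoldt function, [nu n = 1 / (n ln n)], and put on the
   edge from [m] to [n = m q] the flow [L(q) / (n ln^2 n)].  Since the sum of
   [L(q)] over [q | n] is [ln n], the inflow at [n] is exactly [nu n]; by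
   Mertens' estimate [sum_(q <= t) L(q) / q = ln t + O(1)] and Abel summation
   the outflow at [m] is at most [nu m + O(1 / (m ln^2 m))].  Let [D] be the set
   of the [n >= N] dividing an element of the primitive set [A], where
   [N <= min A].  An edge ending in [D] starts either below [N] or in [D \ A],
   by primitivity.  The total flow crossing [N] is at most [1 + O(1 / ln N)],
   again by Mertens, so
     [nu(D) <= 1 + O(1 / ln N) + nu(D \ A) + sum_(m >= N) O(1 / (m ln^2 m))],
   and subtracting [nu(D \ A)] bounds [nu(A)]. *)

(** * The von Mangoldt function and its sum over divisors *)

(* [ln p] if [d] is a positive power of the prime [p], and [0] otherwise; as a
   double sum it is visibly nonnegative and easy to sum over divisors. *)
Definition mangoldt {R : realType} (d : nat) : R :=
  \sum_(1 <= p < d.+1 | prime p) \sum_(1 <= k < d.+1 | d == (p ^ k)%N) ln p%:R.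

Lemma ln_nat_ge0 (R : realType) (n : nat) : 0 <= ln n%:R :> R.
Proof.
case: n => [|n]; first by rewrite ln0.
by apply: ln_ge0; rewrite ler1n.
Qed.

Lemma ln_nat_gt0 (R : realType) (n : nat) : (2 <= n)%N -> 0 < ln n%:R :> R.
Proof. by move=> n2; apply: ln_gt0; rewrite ltr1n. Qed.

Lemma le_ln_nat (R : realType) (m n : nat) : (m <= n)%N -> ln m%:R <= ln n%:R :> R.
Proof.
case: m => [|m] mn; first by rewrite ln0// ln_nat_ge0.
by rewrite ler_ln ?posrE ?ltr0n ?ler_nat// (leq_trans _ mn).
Qed.

Lemma ln_natM (R : realType) (m n : nat) : (0 < m)%N -> (0 < n)%N ->
  ln (m * n)%:R = ln m%:R + ln n%:R :> R.
Proof. by move=> m0 n0; rewrite natrM lnM// posrE ltr0n. Qed.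

Lemma mangoldt_ge0 (R : realType) (d : nat) : 0 <= mangoldt d :> R.
Proof. by rewrite sumr_ge0// => p _; rewrite sumr_ge0// => k _; exact: ln_nat_ge0. Qed.

(** Gives all [d] a common range, so that sums can be exchanged; the added terms vanish, since
    [p ^ k = d] with [k >= 1] forces [p <= d] and [k < d]. *)
Lemma mangoldt_widen (R : realType) (d n : nat) : (0 < d <= n)%N ->
  mangoldt d =
  \sum_(1 <= p < n.+1 | prime p) \sum_(1 <= k < n.+1 | d == (p ^ k)%N) ln p%:R :> R.
Proof.
move=> /andP[d0 dn]; rewrite /mangoldt (big_nat_widen _ _ n.+1)//.
rewrite [LHS]big_mkcond [RHS]big_mkcond/=; apply: eq_big_nat => p /andP[p0 _].
have [pp|//] := boolP (prime p); rewrite /=.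
case: ltnP => [pd|dp].
  rewrite (big_nat_widen _ _ n.+1)//; apply: eq_bigl => k.
  by case: eqP => //= ->; apply/esym; rewrite ltnS ltnW// ltn_expl// prime_gt1.
rewrite big_nat_cond big1// => k /andP[/andP[k0 _] /eqP dE].
move: dp; rewrite dE -{2}(expn1 p) ltn_exp2l ?prime_gt1//.
by lia.
Qed.

Lemma ln_prime_decomp (R : realType) (n : nat) : (0 < n)%N ->
  ln n%:R = \sum_(1 <= p < n.+1 | prime p) (logn p n)%:R * ln p%:R :> R.
Proof.
move=> n0.
have ln_prod m : ln (\prod_(1 <= p < m.+1) p ^ logn p n)%:R =
    \sum_(1 <= p < m.+1 | prime p) (logn p n)%:R * ln p%:R :> R.
  elim: m => [|m ihm]; first by rewrite !big_geq ?ln1.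
  rewrite big_nat_recr//= [RHS]big_mkcond [RHS]big_nat_recr//= -big_mkcond -ihm ln_natM.
  - congr +%R; rewrite natrX lnXn ?ltr0n// mulr_natl; case: ifPn => // /negbTE pF.
    by rewrite lognE pF.
  - by rewrite big_nat_cond prodn_cond_gt0// => i /andP[/andP[i0 _] _]; rewrite expn_gt0 i0.
  - by rewrite expn_gt0.
rewrite -ln_prod -[in LHS](partnT n0) /partn [in LHS]big_ltn_cond//=.
by rewrite lognE/= expn0 mul1n.
Qed.

(** The powers of a prime [p] dividing [n] have exponents [1, ..., logn p n], so [ln p] is counted
    [logn p n] times. *)
Lemma sum_mangoldt_dvdn (R : realType) (n N : nat) : (0 < n <= N)%N ->
  \sum_(1 <= d < N.+1 | (d %| n)%N) mangoldt d = ln n%:R :> R.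
Proof.
move=> /andP[n0 nN].
transitivity (\sum_(1 <= d < N.+1) \sum_(1 <= p < N.+1 | prime p)
    \sum_(1 <= k < N.+1) if (d == p ^ k)%N && (d %| n)%N then ln p%:R else 0 : R).
  rewrite big_mkcond; apply: eq_big_nat => d; rewrite ltnS => dN.
  case: ifPn => dn.
    rewrite (mangoldt_widen _ dN); apply: eq_bigr => p _.
    by rewrite big_mkcond; apply: eq_bigr => k _; rewrite andbT.
  by rewrite big1// => p _; rewrite big1// => k _; rewrite andbF.
rewrite exchange_big/=.
transitivity (\sum_(1 <= p < N.+1 | prime p) (logn p n)%:R * ln p%:R : R).
  apply: eq_bigr => p pp; rewrite exchange_big/=.
  transitivity (\sum_(1 <= k < N.+1 | (k < (logn p n).+1)%N) ln p%:R : R).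
    rewrite [RHS]big_mkcond; apply: eq_bigr => k _.
    rewrite ltnS -pfactor_dvdn// -big_mkcond.
    under eq_bigl => d do rewrite andbC.
    rewrite big_mkcondl.
    rewrite big_nat1_eq.
    have [pkn|_] := boolP (p ^ k %| n)%N; last by rewrite if_same.
    by rewrite expn_gt0 prime_gt0//= ltnS (leq_trans (dvdn_leq _ pkn)).
  rewrite -[LHS](big_nat_widen 1 _ _ predT (fun=> ln p%:R)); last first.
    by rewrite ltnS (leq_trans _ nN)// ltnW// ltn_logl.
  by rewrite sumr_const_nat subn1 mulr_natl.
rewrite ln_prime_decomp// [RHS](big_nat_widen _ _ N.+1)// [LHS]big_mkcond [RHS]big_mkcond.
apply: eq_big_nat => p _; case: ifPn => //= pp; case: ltnP => // np.
by rewrite lognE pp n0 gtnNdvd// mul0r.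
Qed.

Lemma mangoldt_le_ln (R : realType) (n : nat) : (0 < n)%N -> mangoldt n <= ln n%:R :> R.
Proof.
move=> n0; rewrite -(@sum_mangoldt_dvdn R n n) ?n0//= big_mkcond big_nat_recr//= dvdnn.
by rewrite lerDr sumr_ge0// => d _; case: ifP => // _; exact: mangoldt_ge0.
Qed.

Lemma mangoldt1 (R : realType) : mangoldt 1 = 0 :> R.
Proof.
by apply/le_anti; rewrite mangoldt_ge0 andbT; have := @mangoldt_le_ln R 1 isT; rewrite ln1.
Qed.

(** * Chebyshev and Mertens estimates *)

Lemma lnS_sub_le (R : realType) (n : nat) : (0 < n)%N ->
  ln n.+1%:R - ln n%:R <= n%:R^-1 :> R.
Proof.
move=> n0; have n0' : 0 < n%:R :> R by rewrite ltr0n.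
rewrite -ln_div ?posrE ?ltr0n// -natr1 mulrDl divff ?gt_eqF// mul1r.
by apply: le_ln1Dx; rewrite (lt_trans (ltrN10 R)) ?invr_gt0.
Qed.

Lemma lnS_sub_ge (R : realType) (n : nat) : (0 < n)%N ->
  n.+1%:R^-1 <= ln n.+1%:R - ln n%:R :> R.
Proof.
move=> n0; have n0' : 0 < n%:R :> R by rewrite ltr0n.
have n1 : 0 < n.+1%:R :> R by rewrite ltr0n.
rewrite -lerN2 opprB -ln_div ?posrE//.
have -> : n%:R / n.+1%:R = 1 - n.+1%:R^-1 :> R.
  by rewrite -[n%:R](addrK 1) natr1 mulrBl divff ?gt_eqF// mul1r.
by apply: le_ln1Dx; rewrite ltrN2 invf_lt1// ltr1n; lia.
Qed.

(** Both sides are [ln N!]: passing from [N] to [N + 1] raises [N %/ d] by one exactly when [d]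
    divides [N + 1]. *)
Lemma sum_ln_mangoldt (R : realType) (N : nat) :
  \sum_(1 <= n < N.+1) ln n%:R =
  \sum_(1 <= d < N.+1) mangoldt d * (N %/ d)%:R :> R.
Proof.
elim: N => [|N ihN]; first by rewrite !big_geq.
rewrite big_nat_recr//= ihN.
transitivity (\sum_(1 <= d < N.+2)
    (mangoldt d * (N %/ d)%:R + if (d %| N.+1)%N then mangoldt d else 0) : R).
  rewrite big_split/= -(big_mkcond (fun d => d %| N.+1)%N) sum_mangoldt_dvdn ?leqnn//.
  by rewrite [in RHS]big_nat_recr//= [(N %/ N.+1)%N]divn_small// mulr0 addr0.
apply: eq_big_nat => d /andP[d0 _]; rewrite divnS// natrD mulrDr addrC.
by congr +%R; case: ifP => _; rewrite ?mulr1 ?mulr0.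
Qed.

(** Each step adds [ln (2n + 1) + ln (2n + 2)], at most [2 ln (n + 1) + 2 ln 2], and [ln 2 <= 1]. *)
Lemma sum_ln_double (R : realType) (n : nat) :
  \sum_(1 <= i < (2 * n).+1) ln i%:R <=
  2 * \sum_(1 <= i < n.+1) ln i%:R + 2 * n%:R :> R.
Proof.
elim: n => [|n ihn]; first by rewrite !big_geq// mulr0 addr0.
rewrite mulnS !addSn add0n 2?big_nat_recr//= [in leRHS]big_nat_recr//=.
have h1 : ln (2 * n).+1%:R <= ln (2 * n).+2%:R :> R by apply: le_ln_nat.
have h2 : ln (2 * n).+2%:R = ln 2%:R + ln n.+1%:R :> R.
  by rewrite -ln_natM// mulnS.
have h3 : ln 2%:R <= 1 :> R.
  by have := @lnS_sub_le R 1 isT; rewrite ln1 subr0 invr1.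
rewrite -[in leRHS]natr1; lra.
Qed.

(* [2n %/ d - 2 * (n %/ d)] is nonnegative, and at least [1] for [n < d <= 2n]. *)
Lemma chebyshev_double (R : realType) (n : nat) :
  \sum_(1 <= d < (2 * n).+1) mangoldt d <=
  \sum_(1 <= d < n.+1) mangoldt d + 2 * n%:R :> R.
Proof.
have := sum_ln_double R n; rewrite !sum_ln_mangoldt.
rewrite (@big_cat_nat _ _ _ n.+1 1 (2 * n).+1)//=; last by lia.
rewrite [in X in _ -> X <= _](@big_cat_nat _ _ _ n.+1 1 (2 * n).+1)//=; last by lia.
set a := \sum_(_ <= _ < _) _; set b := \sum_(_ <= _ < _) _.
set c := \sum_(_ <= _ < _) _; set e := \sum_(_ <= _ < _) _.
set f := \sum_(_ <= _ < _) _.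
have ac : 2 * c <= a.
  rewrite mulr_sumr; apply: ler_sum_nat => d /andP[d0 _].
  rewrite mulrCA ler_wpM2l ?mangoldt_ge0// -natrM ler_nat leq_divRL//.
  by rewrite -mulnA leq_mul2l leq_trunc_div.
have fb : f <= b.
  apply: ler_sum_nat => d /andP[nd dn]; rewrite ler_peMr ?mangoldt_ge0//.
  by rewrite ler1n divn_gt0; lia.
lra.
Qed.

(** Induction by halving; the constant [4] leaves room for the extra term [ln (2n + 1) <= 2n] of the
    odd case. *)
Lemma chebyshev_le (R : realType) (N : nat) :
  \sum_(1 <= d < N.+1) mangoldt d <= 4 * N%:R :> R.
Proof.
elim/ltn_ind: N => N ihN; have [->|N0] := posnP N; first by rewrite big_geq// mulr0.
pose n := N./2.
have ihn := ihN n ltac:(lia); have hn := chebyshev_double R n.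
have := odd_double_half N; rewrite -/n -mul2n; case: (odd N) => /= <-.
  rewrite add1n big_nat_recr//=.
  have := @mangoldt_le_ln R (2 * n).+1 isT.
  have : ln (2 * n).+1%:R <= (2 * n)%:R :> R.
    by rewrite -natr1 addrC le_ln1Dx// (lt_le_trans (ltrN10 R)).
  rewrite -[(2 * n).+1%:R]natr1 natrM; have := ler0n R n; lra.
rewrite add0n natrM; have := ler0n R n; lra.
Qed.

Lemma sum_ln_le (R : realType) (N : nat) :
  \sum_(1 <= n < N.+1) ln n%:R <= N%:R * ln N%:R :> R.
Proof.
have -> : N%:R * ln N%:R = \sum_(1 <= n < N.+1) ln N%:R :> R.
  by rewrite sumr_const_nat subn1 mulr_natl.
by apply: ler_sum_nat => n /andP[_ nN]; exact: le_ln_nat.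
Qed.

Lemma sum_ln_ge (R : realType) (N : nat) :
  N%:R * ln N%:R - N%:R <= \sum_(1 <= n < N.+1) ln n%:R :> R.
Proof.
elim: N => [|N ihN]; first by rewrite big_geq// mul0r subr0.
rewrite big_nat_recr//=.
have [->|N0] := posnP N; first by rewrite big_geq// ln1 mulr0 sub0r addr0 lerN10.
have N0' : 0 < N%:R :> R by rewrite ltr0n.
have := lnS_sub_le R N0; rewrite -[N%:R^-1]mul1r ler_pdivlMr//.
rewrite -[N.+1%:R]natr1; nra.
Qed.

(** Compare with [ln N!], replacing [N %/ d] by the larger [N / d]. *)
Lemma mertens_ge (R : realType) (N : nat) : (0 < N)%N ->
  ln N%:R - 1 <= \sum_(1 <= d < N.+1) mangoldt d / d%:R :> R.
Proof.
move=> N0; have N0' : 0 < N%:R :> R by rewrite ltr0n.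
rewrite -(ler_pM2l N0') mulrBr mulr1 (le_trans (sum_ln_ge R N))//.
rewrite sum_ln_mangoldt mulr_sumr; apply: ler_sum_nat => d /andP[d0 _].
rewrite mulrCA ler_wpM2l ?mangoldt_ge0// ler_pdivlMr ?ltr0n//.
by rewrite -natrM ler_nat leq_trunc_div.
Qed.

(** Here [N / d <= N %/ d + 1], and the error is the Chebyshev sum, whose bound [4 N] gives the
    constant. *)
Lemma mertens_le (R : realType) (N : nat) : (0 < N)%N ->
  \sum_(1 <= d < N.+1) mangoldt d / d%:R <= ln N%:R + 4 :> R.
Proof.
move=> N0; have N0' : 0 < N%:R :> R by rewrite ltr0n.
rewrite -(ler_pM2l N0') mulrDr.
have h1 := sum_ln_le R N; have h2 := chebyshev_le R N.
suff : N%:R * (\sum_(1 <= d < N.+1) mangoldt d / d%:R) <=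
  \sum_(1 <= n < N.+1) ln n%:R + \sum_(1 <= d < N.+1) mangoldt d :> R by lra.
rewrite sum_ln_mangoldt mulr_sumr -big_split/=; apply: ler_sum_nat => d /andP[d0 _].
rewrite mulrCA -[X in _ + X]mulr1 -mulrDr ler_wpM2l ?mangoldt_ge0//.
rewrite ler_pdivrMr ?ltr0n// natr1 -natrM ler_nat.
by rewrite ltnW// ltn_ceil.
Qed.

(** For [K >= 2], subtract the lower bound at [K - 1] from the upper bound at [q]: [6] is [4 + 1]
    plus at most [1] for [ln K - ln (K - 1)]. *)
Lemma mertens_tail_le (R : realType) (K q : nat) : (0 < K <= q)%N ->
  \sum_(K <= d < q.+1) mangoldt d / d%:R <= ln q%:R - ln K%:R + 6 :> R.
Proof.
move=> /andP[K0 Kq]; have q0 : (0 < q)%N by lia.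
have hq := mertens_le R q0.
case: K K0 Kq => [//|[|K]] _ Kq; first by rewrite ln1; lra.
have hK := @mertens_ge R K.+1 isT.
move: hq; rewrite (@big_cat_nat _ _ _ K.+2 1 q.+1)//=; last by lia.
have := @lnS_sub_le R K.+1 isT.
have : K.+1%:R^-1 <= 1 :> R by rewrite invf_le1 ?ltr0n// ler1n.
by move: (K.+1%:R^-1) (ln K.+1%:R) (ln K.+2%:R) hK => u v w; lra.
Qed.

(** * Abel summation and the outflow of a vertex *)

Lemma abel_le (R : realFieldType) (a b g : nat -> R) (K n : nat) :
  (forall q, (K <= q)%N -> 0 <= g q.+1 <= g q) ->
  (forall q, (K <= q)%N -> \sum_(K <= i < q) a i <= \sum_(K <= i < q) b i) ->
  \sum_(K <= i < n) a i * g i <= \sum_(K <= i < n) b i * g i.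
Proof.
move=> g_dec ab; have [nK|/ltnW Kn] := leqP n K; first by rewrite !big_geq.
have [k ->] : exists k, n = (K + k)%N by exists (n - K)%N; lia.
(* Summation by parts as an induction invariant: the surplus of the partial sums, weighted by the
   current [g], is kept on the left. *)
suff : (\sum_(K <= i < K + k) b i - \sum_(K <= i < K + k) a i) * g (K + k)%N <=
    \sum_(K <= i < K + k) b i * g i - \sum_(K <= i < K + k) a i * g i.
  move=> h; rewrite -subr_ge0 (le_trans _ h)// mulr_ge0 ?subr_ge0 ?ab ?leq_addr//.
  have /andP[h1 h2] := g_dec (K + k)%N (leq_addr _ _); exact: le_trans h1 h2.
elim: k => [|k ihk]; first by rewrite addn0 !big_geq// !subrr mul0r.
have Kk : (K <= K + k)%N by exact: leq_addr.
have := ab (K + k).+1 (leqW Kk).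
rewrite addnS !big_nat_recr//=.
have /andP[h1 h2] := g_dec _ Kk.
rewrite -subr_ge0 => /ler_wpM2l/(_ _ _ h2); lra.
Qed.

(** A discrete form of the integral of [1 / t^2] from [u] to [v]; for consecutive logarithms the
    right side telescopes. *)
Lemma sub_div_sqr_le (R : realFieldType) (u v : R) : 0 < u -> u <= v ->
  (v - u) * (v ^+ 2)^-1 <= u^-1 - v^-1.
Proof.
move=> u0 uv; have v0 : 0 < v by exact: lt_le_trans uv.
have -> : u^-1 - v^-1 = (v - u) * (u * v)^-1 by field; rewrite !gt_eqF.
rewrite ler_wpM2l ?subr_ge0// lef_pV2 ?posrE ?mulr_gt0 ?exprn_gt0//.
by rewrite expr2 ler_wpM2r// ltW.
Qed.

(** Abel summation trades [mangoldt q / q] for increments of [ln q], which telescope against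
    [1 / ln^2] to the first term; the Mertens error [6], placed at [q = K], gives the second. *)
Lemma outflow_le (R : realType) (m K n : nat) : (2 <= m * K)%N ->
  \sum_(K <= q < n) mangoldt q / q%:R * (ln (m * q)%:R ^+ 2)^-1 <=
  (ln (m * K)%:R)^-1 + 6 * (ln (m * K)%:R ^+ 2)^-1 :> R.
Proof.
move=> mK; have [m0 K0] : (0 < m)%N /\ (0 < K)%N by split; lia.
have lnK q : (K <= q)%N -> 0 < ln (m * q)%:R :> R.
  by move=> Kq; apply: ln_nat_gt0; rewrite (leq_trans mK)// leq_mul2l Kq orbT.
pose g q : R := (ln (m * q)%:R ^+ 2)^-1.
(* The partial sums of [b] are the bounds of [mertens_tail_le]. *)
pose b q : R := if q == K then 6 else ln q%:R - ln q.-1%:R.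
have sum_b k : \sum_(K <= q < (K + k).+1) b q = ln (K + k)%:R - ln K%:R + 6.
  elim: k => [|k ihk]; first by rewrite addn0 big_nat1 /b eqxx subrr add0r.
  rewrite addnS big_nat_recr/= ?ihk; last by rewrite leqW// leq_addr.
  rewrite /b ifF/=; last by apply/eqP; lia.
  by ring.
apply: (@le_trans _ _ (\sum_(K <= q < n) b q * g q)).
  apply: abel_le => q Kq.
    rewrite invr_ge0 exprn_ge0 ?ln_nat_ge0//= lef_pV2 ?posrE ?exprn_gt0 ?lnK ?leqW//.
    by rewrite ler_sqr ?nnegrE ?ln_nat_ge0// le_ln_nat// leq_mul2l leqnSn orbT.
  move: Kq; rewrite leq_eqVlt => /predU1P[<-|]; first by rewrite !big_geq.
  case: q => // q Kq; rewrite (le_trans (mertens_tail_le _ _)) ?K0//.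
  by have := sum_b (q - K)%N; rewrite subnKC// => ->.
have [nK|/ltnW Kn] := leqP n K.
  by rewrite big_geq// addr_ge0 ?invr_ge0 ?mulr_ge0 ?invr_ge0 ?exprn_ge0 ?ln_nat_ge0.
have [k ->] : exists k, n = (K + k)%N by exists (n - K)%N; lia.
case: k => [|k].
  by rewrite addn0 big_geq// addr_ge0 ?invr_ge0 ?mulr_ge0 ?invr_ge0 ?exprn_ge0 ?ln_nat_ge0.
(* The subtracted last term makes the bound telescope in [k]. *)
suff : \sum_(K <= q < (K + k).+1) b q * g q <=
    (ln (m * K)%:R)^-1 + 6 * g K - (ln (m * (K + k))%:R)^-1.
  have : 0 < (ln (m * (K + k))%:R)^-1 :> R by rewrite invr_gt0 lnK// leq_addr.
  rewrite addnS /g; lra.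
elim: k => [|k ihk]; first by rewrite addn0 big_nat1 /b eqxx; lra.
have Kk : (K <= K + k)%N by exact: leq_addr.
rewrite addnS big_nat_recr/=; last by rewrite leqW.
have := @sub_div_sqr_le R (ln (m * (K + k))%:R) (ln (m * (K + k).+1)%:R) (lnK _ Kk).
rewrite le_ln_nat ?leq_mul2l ?leqnSn ?orbT// => /(_ isT).
rewrite {2}/b ifF/=; last by apply/eqP; lia.
(* The common [ln m] cancels: [ln (m * q)] has the increments of [ln q]. *)
rewrite [in X in X * _ <= _]ln_natM// [in X in X * _ <= _]ln_natM//; last by lia.
rewrite -/(g (K + k).+1) opprD addrACA subrr add0r; lra.
Qed.

(** * Sums for the error terms *)

Lemma ln2_ge (R : realType) : 2^-1 <= ln 2%:R :> R.
Proof. by have := @lnS_sub_ge R 1 isT; rewrite ln1 subr0. Qed.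

(** For [m > N], [1 / m <= ln m - ln (m - 1)] makes the sum telescope to at most [1 / ln N]; the
    term [m = N] costs another [1 / ln N], as [N ln N >= 1]. *)
Lemma sum_inv_ln_sqr_le (R : realType) (N n : nat) : (2 <= N)%N ->
  \sum_(N <= m < n) m%:R^-1 * (ln m%:R ^+ 2)^-1 <= 2 * (ln N%:R)^-1 :> R.
Proof.
move=> N2; have lnN m : (N <= m)%N -> 0 < ln m%:R :> R.
  by move=> Nm; apply: ln_nat_gt0; lia.
have [nN|Nn] := leqP n N.
  by rewrite big_geq// mulr_ge0// invr_ge0 ltW// lnN.
have [k ->] : exists k, n = (N + k).+1 by exists (n - N).-1; lia.
suff : \sum_(N <= m < (N + k).+1) m%:R^-1 * (ln m%:R ^+ 2)^-1 <=
    2 * (ln N%:R)^-1 - (ln (N + k)%:R)^-1 :> R.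
  have : 0 < (ln (N + k)%:R)^-1 :> R by rewrite invr_gt0 lnN// leq_addr.
  lra.
elim: k => [|k ihk].
  rewrite addn0 big_nat1.
  suff : N%:R^-1 * (ln N%:R ^+ 2)^-1 <= (ln N%:R)^-1 :> R by lra.
  rewrite expr2 invfM mulrA ler_piMl ?invr_ge0 ?ln_nat_ge0// -invfM.
  rewrite invf_le1 ?mulr_gt0 ?lnN ?ltr0n//; last by lia.
  have : 2 <= N%:R :> R by rewrite ler_nat.
  have := le_trans (ln2_ge R) (le_ln_nat R N2); nra.
have Nk : (N <= N + k)%N by exact: leq_addr.
rewrite addnS big_nat_recr/=; last by rewrite leqW.
have := @sub_div_sqr_le R (ln (N + k)%:R) (ln (N + k).+1%:R) (lnN _ Nk).
rewrite le_ln_nat// => /(_ isT).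
have : (N + k).+1%:R^-1 * (ln (N + k).+1%:R ^+ 2)^-1 <=
    (ln (N + k).+1%:R - ln (N + k)%:R) * (ln (N + k).+1%:R ^+ 2)^-1 :> R.
  by rewrite ler_wpM2r ?invr_ge0 ?exprn_ge0 ?ln_nat_ge0// lnS_sub_ge//; lia.
move: ihk (_ * _) (_ * _) => ihk u v; lra.
Qed.

Lemma harmonic_le (R : realType) (N : nat) : (0 < N)%N ->
  \sum_(1 <= m < N.+1) m%:R^-1 <= 1 + ln N%:R :> R.
Proof.
case: N => // N _; elim: N => [|N ihN]; first by rewrite big_nat1 ln1 invr1 addr0.
rewrite big_nat_recr//=; have := @lnS_sub_ge R N.+1 isT.
move: (N.+2%:R^-1) (ln N.+1%:R) (ln N.+2%:R) ihN => u v w; lra.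
Qed.

(** * The flow argument *)

Lemma sum_multiples (R : nmodType) (G : nat -> R) (q M : nat) : (0 < q)%N ->
  \sum_(1 <= n < M | (q %| n)%N) G n = \sum_(1 <= m < M | (m * q < M)%N) G (m * q)%N.
Proof.
move=> q0.
transitivity (\sum_(1 <= n < M) \sum_(1 <= m < M) if n == (m * q)%N then G n else 0).
  rewrite big_mkcond; apply: eq_big_nat => n /andP[n0 nM].
  case: ifPn => [/dvdnP[k nE]|qn].
    rewrite -big_mkcond (eq_bigl (fun m => m == k)); last first.
      by move=> m; rewrite nE eqn_pmul2r// eq_sym.
    by rewrite big_nat1_eq ifT//; nia.
  rewrite big1// => m _; case: eqP => // nE.
  by move: qn; rewrite nE dvdn_mull.
rewrite exchange_big/= [RHS]big_mkcond; apply: eq_big_nat => m /andP[m0 mM].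
by rewrite -big_mkcond big_nat1_eq muln_gt0 m0 q0.
Qed.

Lemma flow_in (R : realType) (M n : nat) : (2 <= n < M)%N ->
  (n%:R * ln n%:R)^-1 =
  \sum_(1 <= q < M | (q %| n)%N) mangoldt q * (n%:R * ln n%:R ^+ 2)^-1 :> R.
Proof.
case: M => [|M]; first by rewrite ltn0 andbF.
move=> /andP[n2 nM]; rewrite -mulr_suml sum_mangoldt_dvdn; last by lia.
have ln0 := ln_nat_gt0 R n2; have n0 : 0 < n%:R :> R by rewrite ltr0n; lia.
by field; rewrite !gt_eqF.
Qed.

(** Everything is cut off at [M] to keep the sums finite; the bound is uniform in [M]. *)
Lemma primitive_sum_le (R : realType) (A : pred nat) (N M : nat) :
  (2 <= N)%N -> (forall a, A a -> (N <= a)%N) ->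
  (forall a b, A a -> A b -> (a %| b)%N -> a = b) ->
  \sum_(N <= a < M | A a) (a%:R * ln a%:R)^-1 <= 1 + 31 / ln N%:R :> R.
Proof.
move=> N2 AN primA; have L0 := ln_nat_gt0 R N2.
have [MN|/ltnW NM] := leqP M N.
  by rewrite big_geq// addr_ge0// divr_ge0// ltW.
pose D n := has (fun a => A a && (n %| a)%N) (index_iota 1 M).
pose nu n : R := (n%:R * ln n%:R)^-1.
(* The flow along the edge from [m] to [m * q]. *)
pose w q m : R := m%:R^-1 * (mangoldt q / q%:R * (ln (m * q)%:R ^+ 2)^-1).
have w_ge0 q m : 0 <= w q m.
  by rewrite !mulr_ge0 ?invr_ge0 ?exprn_ge0 ?mangoldt_ge0 ?ln_nat_ge0.
pose inn m q := [&& (m * q < M)%N, (N <= m * q)%N & D (m * q)%N].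
(* Each target [n] receives exactly [nu n], so [nu(D)] is the flow along the edges ending in [D],
   sorted here by source. *)
have flowE : \sum_(N <= n < M | D n) nu n =
    \sum_(1 <= m < M) \sum_(1 <= q < M | inn m q) w q m.
  rewrite (big_nat_widenl _ 1); last by lia.
  transitivity (\sum_(1 <= n < M) \sum_(1 <= q < M | (q %| n)%N)
      if D n && (N <= n)%N then mangoldt q * (n%:R * ln n%:R ^+ 2)^-1 else 0 : R).
    rewrite big_mkcond; apply: eq_big_nat => n /andP[n0 nM].
    case: ifPn => [/andP[_ Nn]|_]; last by rewrite big1.
    by rewrite /nu (@flow_in _ M)//; lia.
  rewrite (exchange_big_dep predT)//=.
  transitivity (\sum_(1 <= q < M) \sum_(1 <= m < M | inn m q) w q m); last first.
    by rewrite [RHS](exchange_big_dep predT).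
  (* With [q] fixed, the targets [n] are reindexed by their sources [m = n / q]. *)
  apply: eq_big_nat => q /andP[q0 _]; rewrite sum_multiples//.
  rewrite [LHS]big_mkcond [RHS]big_mkcond; apply: eq_big_nat => m /andP[m0 _].
  rewrite /inn; case: ltnP => //= _; rewrite andbC; case: ifP => // _.
  by rewrite /w natrM !invfM; ring.
have flow_low m : (1 <= m < N)%N ->
    \sum_(1 <= q < M | inn m q) w q m <=
    m%:R^-1 * ((ln N%:R)^-1 + 6 * (ln N%:R ^+ 2)^-1).
  (* [K] is the ceiling of [N / m], the least [q] with [N <= m * q]. *)
  move=> /andP[m0 mN]; pose K := (N.-1 %/ m).+1.
  have NmK : (N <= m * K)%N by have := ltn_ceil N.-1 m0; rewrite -/K; lia.
  apply: (@le_trans _ _ (\sum_(K <= q < M) w q m)).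
    rewrite (big_nat_widenl K 1)// [leLHS]big_mkcond [leRHS]big_mkcond.
    apply: ler_sum => q _; case: ifPn => [/and3P[_ Nmq _]|_]; last by case: ifP.
    by rewrite ifT//= /K ltn_divLR//; lia.
  rewrite -mulr_sumr ler_wpM2l ?invr_ge0//.
  apply: le_trans (@outflow_le R m K M _) _; first by lia.
  have lnmK := le_ln_nat R NmK.
  have h1 : (ln (m * K)%:R)^-1 <= (ln N%:R)^-1 :> R.
    by rewrite lef_pV2 ?posrE ?(lt_le_trans L0).
  have h2 : (ln (m * K)%:R ^+ 2)^-1 <= (ln N%:R ^+ 2)^-1 :> R.
    by rewrite lef_pV2 ?posrE ?exprn_gt0 ?(lt_le_trans L0)// ler_sqr ?nnegrE ?ln_nat_ge0.
  by lra.
(* The difference of the two conditionals is [nu m] on [D \ A] and [0] elsewhere, as [A m] implies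
   [D m]. *)
have flow_high m : (N <= m < M)%N ->
    \sum_(1 <= q < M | inn m q) w q m <=
    (if D m then nu m else 0) - (if A m then nu m else 0) +
    6 * (m%:R^-1 * (ln m%:R ^+ 2)^-1).
  move=> /andP[Nm mM]; have m0 : (0 < m)%N by lia.
  have t0 : 0 <= m%:R^-1 * (ln m%:R ^+ 2)^-1 :> R.
    by rewrite mulr_ge0 ?invr_ge0 ?exprn_ge0 ?ln_nat_ge0.
  have nu0 : 0 <= nu m by rewrite invr_ge0 mulr_ge0 ?ln_nat_ge0.
  have AD : A m -> D m.
    by move=> Am; apply/hasP; exists m; rewrite ?Am ?dvdnn// mem_index_iota m0.
  have [DA|DA] := boolP (D m && ~~ A m).
    have /andP[-> /negbTE ->] := DA; rewrite subr0.
    apply: (@le_trans _ _ (\sum_(1 <= q < M) w q m)).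
      by rewrite [leLHS]big_mkcond; apply: ler_sum => q _; case: ifP.
    rewrite -mulr_sumr (le_trans (ler_wpM2l _ (@outflow_le R m 1 M _))) ?invr_ge0//.
      by rewrite muln1; lia.
    by rewrite muln1 /nu invfM; lra.
  rewrite [leLHS]big_nat_cond big1.
    have : (if A m then nu m else 0) <= (if D m then nu m else 0).
      by case: ifPn => [/AD ->//|_]; case: ifP.
    by lra.
  move=> q /andP[/andP[q0 qM] /and3P[_ _ /hasP[a aM /andP[Aa mqa]]]].
  (* By primitivity, [m * q] dividing an element of [A] forces [D m] and, for [q > 1], [~~ A m]. *)
  have [->|q1] := eqVneq q 1%N; first by rewrite /w mangoldt1 !mul0r mulr0.
  case/negP: DA; have ma : (m %| a)%N := dvdn_trans (dvdn_mulr q (dvdnn m)) mqa.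
  have a0 : (0 < a)%N by have := AN _ Aa; lia.
  apply/andP; split; first by apply/hasP; exists a; rewrite ?Aa.
  apply/negP => Am; have mE := primA _ _ Am Aa ma.
  by have := dvdn_leq a0 mqa; rewrite -mE; nia.
(* [flowE] is applied on the left only: [nu(D)] stays on the right and cancels, leaving the sum over
   [A]. *)
have AD_le : \sum_(N <= n < M | D n) nu n <=
    (1 + ln N%:R) * ((ln N%:R)^-1 + 6 * (ln N%:R ^+ 2)^-1) +
    (\sum_(N <= n < M | D n) nu n - \sum_(N <= n < M | A n) nu n +
     6 * (2 * (ln N%:R)^-1)).
  rewrite {1}flowE (@big_cat_nat _ _ _ N)//=; last by lia.
  apply: lerD.
    apply: (le_trans (ler_sum_nat flow_low)); rewrite -mulr_suml ler_wpM2r//.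
      by rewrite addr_ge0 ?mulr_ge0 ?invr_ge0 ?exprn_ge0// ltW.
    (* The low sources stop at [N - 1], so the harmonic bound is taken there. *)
    case: N N2 {AN L0 NM inn flowE flow_low flow_high} => // N N2.
    rewrite (le_trans (harmonic_le R _)) ?lerD2l ?le_ln_nat//; lia.
  apply: (le_trans (ler_sum_nat flow_high)).
  rewrite big_split/= sumrB -!big_mkcond lerD2l -mulr_sumr ler_wpM2l//.
  exact: sum_inv_ln_sqr_le.
have l2 : (ln N%:R)^-1 <= 2 :> R.
  have h := le_trans (ln2_ge R) (le_ln_nat R N2).
  by rewrite -(invrK 2) lef_pV2 ?posrE// invr_gt0.
have e : (1 + ln N%:R) * ((ln N%:R)^-1 + 6 * (ln N%:R ^+ 2)^-1) =
    1 + 7 * (ln N%:R)^-1 + 6 * ((ln N%:R)^-1 * (ln N%:R)^-1) :> R.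
  by field; rewrite gt_eqF.
have l3 : (ln N%:R)^-1 * (ln N%:R)^-1 <= 2 * (ln N%:R)^-1 :> R.
  by rewrite ler_wpM2r// invr_ge0 ltW.
(* [31 = 7 + 12 + 12]: the [7] of [e], then [6 / ln^2 N <= 12 / ln N], then the error of the sources
   from [N] on. *)
move: AD_le; rewrite e /nu; lra.
Qed.

(** * Passage to infinite sets and a real threshold *)

Theorem theorem1p1 (R : realType) :
  exists C : R, 0 < C /\
    forall (x : R), 2 <= x ->
    forall (A : set nat),
      (forall a : nat, A a -> (1 <= a)%N /\ x <= (a%:R : R)) ->
      primitive A ->
      (fsum R A <= (1 + C / ln x)%:E)%E.
Proof.
exists 31; split => // x x2 A Ax primA.
have exN : exists n, x <= n%:R.
  by exists (Num.bound x); rewrite ltW// archi_boundP// (le_trans _ x2).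
(* [N] is the ceiling of [x]: it still bounds [A] below, and [ln x <= ln N]. *)
case: (ex_minnP exN) => N xN minN.
have N2 : (2 <= N)%N by rewrite -(ler_nat R) (le_trans x2).
(* The infinite sum is the supremum over finite [X] inside [A]; such an [X] is again primitive and
   lies in [[N, M)]. *)
apply: ge_ereal_sup => _ [X [finX XA] <-].
pose M := (\max_(a <- finmap.enum_fset (fset_set X)) a).+1.
have XM a : X a -> (a < M)%N.
  by move=> Xa; rewrite ltnS (@leq_bigmax_seq _ _ predT id a)// in_fset_set// inE.
rewrite (fsbigE [seq a <- index_iota N M | a \in X]).
- rewrite big_filter_cond sumEFin lee_fin.
  apply: le_trans (_ : 1 + 31 / ln N%:R <= _).
    rewrite (eq_bigl (fun a => a \in X)); last by move=> a; rewrite andbb.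
    apply: primitive_sum_le => // [a|a b].
      by rewrite inE => /XA /Ax[_ /minN].
    by rewrite !inE => /XA Aa /XA Ab; exact: primA.
  have lnx : 0 < ln x by rewrite ln_gt0// (lt_le_trans _ x2)// ltr1n.
  have lnxN : ln x <= ln N%:R.
    have x0 : 0 < x by exact: lt_le_trans x2.
    by rewrite ler_ln ?posrE// (lt_le_trans x0).
  by rewrite lerD2l ler_pM2l// lef_pV2// posrE (lt_le_trans lnx).
- by rewrite filter_uniq// iota_uniq.
- by move=> a /=; rewrite mem_filter => /andP[/set_mem].
- move=> a Xa; rewrite mem_filter mem_index_iota XM// (mem_set Xa) andbT => /negP[].
  by apply: minN; case: (Ax a (XA _ Xa)).
Qed.
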